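(* Consider the problem of maximizing $$f_3(\bm{\phi})=\sum_{k=1}^{K}\frac{\tilde{\alpha}_k|\bm{\phi}^H\bm{b}_{k,k}|^2}{\sum_{i=1}^{K}|\bm{\phi}^H\bm{b}_{i,k}|^2+\sigma_0^2}$$ over $\bm{\phi}=[\phi_1,\dots,\phi_N]^T\in\mathbb{C}^N$ subject to $|\phi_n|=1$, $n=1,\dots,N$, through its quadratic transform $$f_{3a}(\bm{\phi},\bm{\varepsilon})=\sum_{k=1}^{K}2\sqrt{\tilde{\alpha}_k}\,\mathrm{Re}\{\varepsilon_k^{*}\bm{\phi}^H\bm{b}_{k,k}\}-\sum_{k=1}^{K}|\varepsilon_k|^2\Big(\sum_{i=1}^{K}|\bm{\phi}^H\bm{b}_{i,k}|^2+\sigma_0^2\Big),\qquad \bm{\varepsilon}=[\varepsilon_1,\dots,\varepsilon_K]^T\in\mathbb{C}^K.$$ (i) For fixed $\bm{\phi}$, the maximizer of $f_{3a}(\bm{\phi},\cdot)$ over $\bm{\varepsilon}\in\mathbb{C}^K$ is given, for $k=1,\dots,K$, by $$\varepsilon_k^{op}=\frac{\sqrt{\tilde{\alpha}_k}\,\bm{\phi}^H\bm{b}_{k,k}}{\sum_{i=1}^{K}|\bm{\phi}^H\bm{b}_{i,k}|^2+\sigma_0^2}.$$ (ii) With $\bm{\varepsilon}^{op}$ held fixed, for each $n\in\{1,\dots,N\}$ and fixed unit-modulus $\phi_q$, $q\ne n$, the optimal $\phi_n$ (maximizing $f_{3a}(\bm{\phi},\bm{\varepsilon}^{op})$ over $|\phi_n|=1$)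 is $$\phi_n^{op}=e^{j\theta_n^{op}},\qquad \theta_n^{op}=\angle B_2,\qquad B_2=v_n-\sum_{q=1,q\ne n}^{N}u_{n,q}\phi_q,$$ where $v_n$ is the $n$-th entry of $\mathbf{V}=\sum_{k=1}^{K}\sqrt{\tilde{\alpha}_k}\,\varepsilon_k^{op*}\bm{b}_{k,k}$ and $u_{n,q}$ is the entry in row $n$ and column $q$ of $\mathbf{U}=\sum_{k=1}^{K}|\varepsilon_k^{op}|^2\sum_{i=1}^{K}\bm{b}_{i,k}\bm{b}_{i,k}^H$.
   Context: $M,N,K$ are positive integers, $\sigma_0^2>0$, $\tilde{\alpha}_k=1+\alpha_k$ with fixed $\alpha_k\ge 0$. The vectors $\bm{b}_{i,k}=\mathrm{diag}(\mathbf{h}_{r,k}^H)\mathbf{G}^H\bm{w}_i\in\mathbb{C}^{N\times 1}$ are fixed, where $\mathbf{h}_{r,k}\in\mathbb{C}^{N\times 1}$, $\mathbf{G}\in\mathbb{C}^{M\times N}$, $\bm{w}_i\in\mathbb{C}^{M\times 1}$, and $\mathrm{diag}(\cdot)$ is the diagonal matrix with the given entries. $j$ is the imaginary unit, $(\cdot)^*$ complex conjugation, $(\cdot)^H$ conjugate transpose, and $\angle x$ the phase angle of $x\in\mathbb{C}$ (arbitrary if $x=0$). *)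

(* Defs.v *)
From mathcomp Require Import all_boot all_order all_algebra.
From mathcomp Require Import complex.
From mathcomp Require Import reals trigo.
From mathcomp Require Import ring lra.

Set Implicit Arguments.
Unset Strict Implicit.
Unset Printing Implicit Defensive.

Import Order.TTheory GRing.Theory Num.Theory.
Import Normc.

Local Open Scope ring_scope.
Local Open Scope complex_scope.
Local Open Scope sesquilinear_scope.

(* Complex numbers are R[i] over a realType R.  normc is the R-valued modulus
   (whereas `|x| lives in R[i]), r%:C embeds R in R[i], z^* is the conjugate
   and A ^t* the conjugate transpose. *)

Definition is_argmax (R : realType) (T : Type) (D : T -> Prop) (f : T -> R)
    (x : T) : Prop :=
  D x /\ forall y : T, D y -> f y <= f x.

Definition expi (R : realType) (theta : R) : R[i] := cos theta +i* sin theta.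

(* "theta is a phase angle of x": determined modulo 2 pi when x != 0, and
   satisfied by every theta when x = 0. *)
Definition is_phase (R : realType) (x : R[i]) (theta : R) : Prop :=
  x = (normc x)%:C * expi theta.

Lemma is_phase_exists (R : realType) (x : R[i]) : exists theta, is_phase x theta.
Proof.
case: x => a b.
have [r0|r_neq0] := eqVneq (normc (a +i* b)) 0.
  by exists 0; rewrite /is_phase r0 mul0r; apply: eq0_normc.
set r := normc (a +i* b) in r_neq0.
have r_gt0 : 0 < r by rewrite lt_def r_neq0 sqrtr_ge0.
have r2 : r ^+ 2 = a ^+ 2 + b ^+ 2 by rewrite sqr_sqrtr // addr_ge0 ?sqr_ge0.
have c2 : (a / r) ^+ 2 <= 1.
  by rewrite expr_div_n r2 ler_pdivrMr -r2 ?exprn_gt0 // mul1r r2 lerDl sqr_ge0.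
have cB : -1 <= a / r <= 1.
  by rewrite -ler_norml -(@expr_le1 _ 2) // real_normK ?num_real.
have cE : cos (acos (a / r)) = a / r by rewrite acosK // in_itv.
have sE : sin (acos (a / r)) = `|b| / r.
  rewrite sin_acos //; have -> : 1 - (a / r) ^+ 2 = (b / r) ^+ 2.
    have -> : (b / r) ^+ 2 = (r ^+ 2 - a ^+ 2) / r ^+ 2.
      by rewrite expr_div_n {2}r2 addrAC subrr add0r.
    by field.
  by rewrite sqrtr_sqr normrM normfV (gtr0_norm r_gt0).
have rot t : a = r * cos t -> b = r * sin t -> is_phase (a +i* b) t.
  by move=> ea eb; rewrite /is_phase -/r /expi /real_complex_def; simpc; rewrite -ea -eb.
have [b0|b0] := lerP 0 b.
  exists (acos (a / r)); apply: rot; rewrite ?cE ?sE ?(ger0_norm b0); by field.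
exists (- acos (a / r)); apply: rot; rewrite ?cosN ?sinN ?cE ?sE ?(ltr0_norm b0);
  by field.
Qed.

(* b_{i,k} = diag(h_{r,k}^H) G^H w_i *)
Definition bvec (R : realType) (M N K : nat) (hr : 'I_K -> 'cV[R[i]]_N)
    (G : 'M[R[i]]_(M, N)) (w : 'I_K -> 'cV[R[i]]_M) (i k : 'I_K) : 'cV[R[i]]_N :=
  diag_mx ((hr k)^t* ) *m G^t* *m w i.

Section Objective.

Context (R : realType) (N K : nat).
Context (b : 'I_K -> 'I_K -> 'cV[R[i]]_N) (alpha : 'I_K -> R) (sigma0 : R).

Implicit Types (phi : 'cV[R[i]]_N) (eps : 'cV[R[i]]_K).

Definition alphat (k : 'I_K) : R := 1 + alpha k.

Definition hdot (x y : 'cV[R[i]]_N) : R[i] := (x ^t* *m y) 0 0.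

Definition denom phi (k : 'I_K) : R :=
  \sum_(i < K) normc (hdot phi (b i k)) ^+ 2 + sigma0 ^+ 2.

Definition f3 phi : R :=
  \sum_(k < K) alphat k * normc (hdot phi (b k k)) ^+ 2 / denom phi k.

Definition f3a phi eps : R :=
  \sum_(k < K) 2 * Num.sqrt (alphat k) * complex.Re ((eps k 0)^* * hdot phi (b k k))
  - \sum_(k < K) normc (eps k 0) ^+ 2 * denom phi k.

Definition eps_op phi : 'cV[R[i]]_K :=
  \col_k ((Num.sqrt (alphat k))%:C * hdot phi (b k k) / (denom phi k)%:C).

Definition Vvec eps : 'cV[R[i]]_N :=
  \sum_(k < K) ((Num.sqrt (alphat k))%:C * (eps k 0)^*) *: b k k.

Definition Umat eps : 'M[R[i]]_N :=
  \sum_(k < K) ((normc (eps k 0) ^+ 2)%:C *: \sum_(i < K) b i k *m (b i k)^t*).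

(* Does not depend on the entry phi n 0. *)
Definition B2 eps phi (n : 'I_N) : R[i] :=
  Vvec eps n 0 - \sum_(q < N | q != n) Umat eps n q * phi q 0.

Definition set_entry phi (n : 'I_N) (z : R[i]) : 'cV[R[i]]_N :=
  \col_q (if q == n then z else phi q 0).

(* The sense in which f3a is a quadratic transform of f3. *)
Lemma f3a_eps_op phi : 0 < sigma0 ^+ 2 -> (forall k, 0 <= alpha k) ->
  f3a phi (eps_op phi) = f3 phi.
Proof.
move=> s_gt0 a_ge0; rewrite /f3a /f3 -sumrB; apply: eq_bigr => k _.
have d_gt0 : 0 < denom phi k.
  by apply: ltr_wpDl => //; apply: sumr_ge0 => i _; apply: sqr_ge0.
have at_ge0 : 0 <= alphat k by rewrite addr_ge0.
rewrite mxE; move: (Num.sqrt _) (sqr_sqrtr at_ge0) => s <-.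
move: (denom _ _) d_gt0 (hdot _ _) => d d_gt0 [x y].
rewrite -fmorphV /real_complex_def !normcM !exprMn /=.
rewrite !sqr_sqrtr ?addr_ge0 ?sqr_ge0 //; simpc => /=.
by field; rewrite lt0r_neq0.
Qed.

End Objective.

(* Main.v *)
(** For fixed [phi], completing the square in each [eps_k] gives
    [f3a phi eps = f3a phi eps_op - sum_k denom_k |eps_k - eps_op_k|^2].
    For fixed [eps], [f3a] is [2 Re (phi^H V) - phi^H U phi] up to a constant,
    so on the circle [|z| = 1] its dependence on the [n]-th entry [z] is
    [2 Re (z^* B2)] up to a constant; this is at most [2 |B2|], with equality
    exactly when [B2 = |B2| z]. *)
Require Import Defs.
From mathcomp Require Import all_boot all_order all_algebra.
From mathcomp Require Import complex.
From mathcomp Require Import reals trigo.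
From mathcomp Require Import ring.

Import Order.TTheory GRing.Theory Num.Theory.
Import Normc.

Local Open Scope ring_scope.
Local Open Scope complex_scope.

(* Both [ring_scope] and [complex_scope] define [^*]; reopening [ring_scope]
   makes it [Num.conj], as under the sums of the definitions. *)
Section Modulus.

Local Open Scope ring_scope.

Context {R : realType}.
Implicit Types (x y z : R[i]).

Lemma sqr_normc x : normc x ^+ 2 = complex.Re x ^+ 2 + complex.Im x ^+ 2.
Proof. by case: x => a b; rewrite /= sqr_sqrtr // addr_ge0 ?sqr_ge0. Qed.

Lemma normc_ge0 x : 0 <= normc x.
Proof. by case: x => a b; apply: sqrtr_ge0. Qed.

Lemma normc_conj x : normc x^* = normc x.
Proof. by case: x => a b /=; rewrite sqrrN. Qed.

Lemma sqr_normcD x y :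
  normc (x + y) ^+ 2 =
  normc x ^+ 2 + 2 * complex.Re (y * x^*) + normc y ^+ 2.
Proof. by rewrite !sqr_normc; case: x y => [a b] [c d] /=; ring. Qed.

Lemma ReZ (r : R) x : complex.Re (r%:C * x) = r * complex.Re x.
Proof. by case: x => a b /=; ring. Qed.

Lemma ReD x y : complex.Re (x + y) = complex.Re x + complex.Re y.
Proof. by case: x y => [a b] [c d]. Qed.

Lemma ReB x y : complex.Re (x - y) = complex.Re x - complex.Re y.
Proof. by case: x y => [a b] [c d]. Qed.

Lemma Re_sum (I : finType) (F : I -> R[i]) :
  complex.Re (\sum_i F i) = \sum_i complex.Re (F i).
Proof. exact: raddf_sum. Qed.

Lemma normc_expi (t : R) : normc (expi t) = 1.
Proof. by rewrite /= cos2Dsin2 sqrtr1. Qed.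

Lemma expi_of_normc1 z : normc z = 1 -> exists t, z = expi t.
Proof.
by case: (is_phase_exists z) => t zt z1; exists t; rewrite zt z1 mul1r.
Qed.

(** A square equal to [2 |x|] times the gap [|x| - Re (z^* x)]: its sign yields the bound on the
    circle, and its vanishing yields the equality case. *)
Lemma sqr_normc_sub_scale x z : normc z = 1 ->
  normc (x - (normc x)%:C * z) ^+ 2 =
  2 * normc x * (normc x - complex.Re (z^* * x)).
Proof.
move=> z1; have := sqr_normc z; rewrite z1 expr1n.
have := sqr_normc x; move: (normc x) => r; rewrite sqr_normc.
case: x z {z1} => [a b] [c d] /= rE zE.
(* The expansion is grouped so that [|x|^2] and [|z|^2] appear literally and can be folded to
   [r ^+ 2] and [1]. *)
transitivity (a ^+ 2 + b ^+ 2 + r ^+ 2 * (c ^+ 2 + d ^+ 2)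
              - 2 * r * (c * a + d * b)); first by ring.
by rewrite -rE -zE; ring.
Qed.

Lemma Re_conj_mul_le x z : normc z = 1 -> complex.Re (z^* * x) <= normc x.
Proof.
move=> z1; have [->|x_neq0] := eqVneq x 0.
  by rewrite mulr0 normc0.
have x_gt0 : 0 < normc x.
  by rewrite lt_def normc_ge0 andbT; apply: contraNneq x_neq0 => /eq0_normc ->.
rewrite -subr_ge0 -(pmulr_rge0 _ (mulr_gt0 (ltr0Sn R 1) x_gt0)).
by rewrite -sqr_normc_sub_scale // sqr_ge0.
Qed.

Lemma Re_conj_mul_eq x z : normc z = 1 ->
  complex.Re (z^* * x) = normc x <-> x = (normc x)%:C * z.
Proof.
move=> z1; split=> [e|e].
  apply/eqP; rewrite -subr_eq0; apply/eqP/eq0_normc/eqP.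
  by rewrite -sqrf_eq0 sqr_normc_sub_scale // e subrr mulr0.
have [x0|x_neq0] := eqVneq (normc x) 0.
  by rewrite (eq0_normc x0) mulr0 normc0.
have := sqr_normc_sub_scale x z z1; rewrite -e subrr normc0 expr0n /=.
move/esym/eqP; rewrite !mulf_eq0 (negPf x_neq0) pnatr_eq0 /= subr_eq0.
by move/eqP.
Qed.

(** The bound [|B|] is attained at any phase of [B], so a maximizer must attain it too, and the
    equality case makes its angle a phase of [B]. If [B = 0], every point of the circle
    qualifies. *)
Lemma argmax_Re_conj_mul (B : R[i]) z :
  is_argmax (fun z' => normc z' = 1) (fun z' => complex.Re (z'^* * B)) z
  <-> exists t, is_phase B t /\ z = expi t.
Proof.
split=> [[z1 zmax]|[t [Bt ->]]].
  have [t zt] := expi_of_normc1 z z1; exists t; split=> //.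
  rewrite /is_phase -zt; apply: (proj1 (Re_conj_mul_eq B z z1)); apply/le_anti.
  rewrite Re_conj_mul_le //=.
  have [s Bs] := is_phase_exists B.
  by rewrite -(proj2 (Re_conj_mul_eq _ _ (normc_expi s)) Bs) zmax // normc_expi.
split=> [|y y1]; first exact: normc_expi.
by rewrite (proj2 (Re_conj_mul_eq _ _ (normc_expi t)) Bt) Re_conj_mul_le.
Qed.

End Modulus.

Section QuadraticTransform.

Local Open Scope ring_scope.

Context {R : realType} {N K : nat}.
Context (b : 'I_K -> 'I_K -> 'cV[R[i]]_N) (alpha : 'I_K -> R) (sigma0 : R).
Implicit Types (phi : 'cV[R[i]]_N) (eps : 'cV[R[i]]_K).

(** * Maximization over [eps] for fixed [phi] *)

Lemma denom_gt0 phi k : 0 < sigma0 ^+ 2 -> 0 < denom b sigma0 phi k.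
Proof. by move=> s0; apply: ltr_wpDl => //; apply: sumr_ge0 => i _; apply: sqr_ge0. Qed.

Lemma f3a_complete_square phi eps : 0 < sigma0 ^+ 2 ->
  f3a b alpha sigma0 phi eps =
  f3a b alpha sigma0 phi (eps_op b alpha sigma0 phi)
  - \sum_(k < K) denom b sigma0 phi k *
      normc (eps k 0 - eps_op b alpha sigma0 phi k 0) ^+ 2.
Proof.
move=> s0; rewrite /f3a -!sumrB; apply: eq_bigr => k _.
rewrite !mxE; have := denom_gt0 phi k s0.
move: (denom _ _ _ _) (Num.sqrt _) (hdot _ _) (eps k 0) => d s [x y] [e f] d0.
rewrite !sqr_normc -fmorphV /real_complex_def /=; simpc => /=.
by field; rewrite lt0r_neq0.
Qed.

Lemma argmax_f3a_eps phi eps : 0 < sigma0 ^+ 2 ->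
  is_argmax (fun _ => True) (f3a b alpha sigma0 phi) eps
  <-> eps = eps_op b alpha sigma0 phi.
Proof.
move=> s0.
have term_ge0 e k : 0 <= denom b sigma0 phi k *
    normc (e k 0 - eps_op b alpha sigma0 phi k 0) ^+ 2.
  by rewrite mulr_ge0 ?sqr_ge0 // ltW ?denom_gt0.
split=> [[_ /(_ (eps_op b alpha sigma0 phi) I)]|->]; last first.
  split=> // e _; rewrite (f3a_complete_square phi e) // gerBl.
  exact: sumr_ge0.
(* A maximizer is at least as good as [eps_op], so the sum of nonnegative penalties is at most 0.
   Each penalty then vanishes, and its weight [denom] is positive. *)
rewrite (f3a_complete_square phi eps) // lerBrDr gerDl => sum_le0.
have /eqP : \sum_(k < K) denom b sigma0 phi k *
    normc (eps k 0 - eps_op b alpha sigma0 phi k 0) ^+ 2 = 0.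
  by apply/le_anti; rewrite sum_le0 sumr_ge0.
rewrite psumr_eq0 // => /allP terms0; apply/matrixP => k j; rewrite ord1.
have := terms0 k (mem_index_enum k).
rewrite /= mulf_eq0 (gt_eqF (denom_gt0 phi k s0)) sqrf_eq0 /=.
by move=> /eqP/eq0_normc/eqP; rewrite subr_eq0 => /eqP.
Qed.

(** * Dependence on a single entry of [phi] *)

Lemma hdotE (x y : 'cV[R[i]]_N) : hdot x y = \sum_q (x q 0)^* * y q 0.
Proof. by rewrite /hdot mxE; apply: eq_bigr => q _; rewrite !mxE. Qed.

Lemma hdot_set_entry phi n z (c : 'cV[R[i]]_N) :
  hdot (set_entry phi n z) c = hdot (set_entry phi n 0) c + z^* * c n 0.
Proof.
rewrite !hdotE (bigD1 n) //= [in RHS](bigD1 n) //= !mxE eqxx.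
rewrite conjC0 mul0r add0r addrC; congr (_ + _).
by apply: eq_bigr => q qn; rewrite !mxE (negPf qn).
Qed.

(** Puts [B2] in the shape of the cross terms of [f3a] around [set_entry phi n 0]: row [n] of [U]
    applied to a vector collects the products [b_n (b^H phi)], and [b^H phi] is the conjugate of
    [phi^H b]. *)
Lemma B2E eps phi n :
  B2 b alpha eps phi n =
  \sum_(k < K) ((Num.sqrt (alphat alpha k))%:C * ((eps k 0)^* * b k k n 0)
    - (normc (eps k 0) ^+ 2)%:C *
      \sum_(i < K) b i k n 0 * (hdot (set_entry phi n 0) (b i k))^*).
Proof.
rewrite sumrB /B2 /Vvec summxE; congr (_ - _).
  by apply: eq_bigr => k _; rewrite mxE mulrA.
(* Zeroing entry [n] lets the sum over [q != n] run over all [q]. *)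
transitivity (\sum_q Umat b eps n q * set_entry phi n 0 q 0).
  rewrite [RHS](bigD1 n) //= mxE eqxx mulr0 add0r.
  by apply: eq_bigr => q qn; rewrite mxE (negPf qn).
rewrite (eq_bigr (fun q => \sum_k (normc (eps k 0) ^+ 2)%:C *
   \sum_i b i k n 0 * ((b i k q 0)^* * set_entry phi n 0 q 0))).
  rewrite exchange_big; apply: eq_bigr => k _ /=.
  rewrite -mulr_sumr exchange_big; congr (_ * _); apply: eq_bigr => i _ /=.
  rewrite -mulr_sumr; congr (_ * _); rewrite hdotE rmorph_sum /=.
  by apply: eq_bigr => q _; rewrite rmorphM /= conjCK mulrC.
move=> q _; rewrite /Umat summxE mulr_suml; apply: eq_bigr => k _.
rewrite mxE -mulrA summxE mulr_suml; congr (_ * _).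
by apply: eq_bigr => i _; rewrite !mxE big_ord1 !mxE mulrA.
Qed.

(** The only term quadratic in [z] carries the factor [|z|^2], which is 1 on the circle; what
    remains is affine in [z]. *)
Lemma f3a_set_entry eps phi n z : normc z = 1 ->
  f3a b alpha sigma0 (set_entry phi n z) eps =
  f3a b alpha sigma0 (set_entry phi n 0) eps
  - \sum_(k < K) normc (eps k 0) ^+ 2 * \sum_(i < K) normc (b i k n 0) ^+ 2
  + 2 * complex.Re (z^* * B2 b alpha eps phi n).
Proof.
move=> z1; rewrite B2E mulr_sumr Re_sum mulr_sumr /f3a -!sumrB -big_split /=.
apply: eq_bigr => k _; rewrite hdot_set_entry.
(* Each [|h + z^* c|^2] is expanded, with [h] the inner product at the zeroed entry and [c] the
   [n]-th entry of [b i k]. *)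
have -> : denom b sigma0 (set_entry phi n z) k =
  denom b sigma0 (set_entry phi n 0) k + 2 * complex.Re (z^* *
    \sum_(i < K) b i k n 0 * (hdot (set_entry phi n 0) (b i k))^*)
  + \sum_(i < K) normc (b i k n 0) ^+ 2.
  rewrite mulr_sumr Re_sum mulr_sumr /denom addrAC -!addrA.
  rewrite [sigma0 ^+ 2 + _]addrC [_ + (_ + sigma0 ^+ 2)]addrA !addrA.
  rewrite -!big_split /=; congr (_ + _); apply: eq_bigr => i _.
  rewrite hdot_set_entry sqr_normcD normcM exprMn.
  by rewrite normc_conj z1 expr1n mul1r mulrA addrAC.
rewrite mulrDr ReD (mulrCA _^* z^*) mulrBr ReB.
rewrite (mulrCA z^* (Num.sqrt _)%:C) (mulrCA z^* (_ ^+ 2)%:C) !ReZ.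
ring.
Qed.

(** On the circle the objective is an increasing affine function of [Re (z^* B2)], so both have the
    same maximizers. As [eps] is arbitrary, this covers [eps_op] frozen at any earlier point. *)
Lemma argmax_f3a_set_entry eps phi n z :
  is_argmax (fun z' => normc z' = 1)
    (fun z' => f3a b alpha sigma0 (set_entry phi n z') eps) z
  <-> exists t, is_phase (B2 b alpha eps phi n) t /\ z = expi t.
Proof.
apply: iff_trans (argmax_Re_conj_mul (B2 b alpha eps phi n) z).
split=> -[z1 zmax]; split=> // y y1; have := zmax y y1;
  by rewrite (f3a_set_entry _ _ _ y y1) (f3a_set_entry _ _ _ z z1) lerD2l ler_pM2l.
Qed.

End QuadraticTransform.

Theorem proposition3 (R : realType) (M N K : nat)
  (hM : (0 < M)%N) (hN : (0 < N)%N) (hK : (0 < K)%N)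
  (hr : 'I_K -> 'cV[R[i]]_N) (G : 'M[R[i]]_(M, N)) (w : 'I_K -> 'cV[R[i]]_M)
  (alpha : 'I_K -> R) (sigma0 : R)
  (halpha : forall k : 'I_K, 0 <= alpha k) (hsigma0 : 0 < sigma0 ^+ 2) :
  let b := bvec hr G w in
  (forall (phi : 'cV[R[i]]_N) (eps : 'cV[R[i]]_K),
     is_argmax (fun _ : 'cV[R[i]]_K => True) (f3a b alpha sigma0 phi) eps
     <-> eps = eps_op b alpha sigma0 phi)
  /\
  (forall (phi0 phi : 'cV[R[i]]_N) (n : 'I_N),
     (forall q : 'I_N, q != n -> normc (phi q 0) = 1) ->
     let eps := eps_op b alpha sigma0 phi0 in
     forall z : R[i],
       is_argmax (fun z' : R[i] => normc z' = 1)
         (fun z' : R[i] => f3a b alpha sigma0 (set_entry phi n z') eps) z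
       <-> exists theta : R, is_phase (B2 b alpha eps phi n) theta /\ z = expi theta).
Proof.
move=> b; split=> [phi eps|phi0 phi n _ eps z].
  exact: argmax_f3a_eps.
exact: argmax_f3a_set_entry.
Qed.
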